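(* For all integers $n,k\geq 0$, $$A_{n+k,k}=\frac{1}{e}\sum_{m=0}^{\infty}\frac{m^k(m-1)^{n}}{m!}.$$
   Context: A partition of a finite set is a collection of nonempty, pairwise disjoint subsets (blocks) whose union is the set; a singleton of a partition is a block with exactly one element, and the element $i$ is called a singleton if $\{i\}$ is a block. For integers $0\leq k\leq n$, $A_{n,k}$ denotes the number of partitions of $\{1,2,\dots,n+1\}$ whose largest singleton is $k+1$ (i.e. $\{k+1\}$ is a block and no $j>k+1$ forms a singleton block). The convention $0^0=1$ is used. *)

(* Defs.v *)
From mathcomp Require Import all_boot.

Set Implicit Arguments.
Unset Strict Implicit.
Unset Printing Implicit Defensive.

(* The ground set {1, ..., N} is modelled by 'I_N: the ordinal i stands for the
   integer i + 1. *)

Definition is_singleton (N : nat) (P : {set {set 'I_N}}) (i : 'I_N) : bool :=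
  [set i] \in P.

Definition largest_singleton (N : nat) (P : {set {set 'I_N}}) (i : 'I_N) : bool :=
  is_singleton P i && [forall j : 'I_N, (i < j)%N ==> ~~ is_singleton P j].

(* The ordinal i with value k stands for k + 1; it exists exactly when k <= n. *)
Definition A (n k : nat) : nat :=
  #|[set P : {set {set 'I_n.+1}} |
      partition P [set: 'I_n.+1] &&
      [exists i : 'I_n.+1, (nat_of_ord i == k) && largest_singleton P i]]|.

(* Main.v *)
Require Import Defs.
From mathcomp Require Import all_boot.

(** Let [W D S] be the number of partitions of [D] in which no element of [S] is
    a singleton. Deleting the block [{k+1}] turns [A (n + k) k] into [W D S]
    with [#|S| = n] and [#|D :\: S| = k]. For [x] in [S], sorting the partitions
    counted by [W D (S :\ x)] according to whether [{x}] is a block gives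
    [W D S = W D (S :\ x) - W (D :\ x) (S :\ x)], which mirrors
    [m^k (m-1)^(n+1) = m^(k+1) (m-1)^n - m^k (m-1)^n] in the series. This
    reduces the claim to [S] empty, i.e. to Dobinski's formula. The latter
    follows from the recurrence on the block of a fixed element, since
    [sum_m m^(k+1) / m! = sum_m (m+1)^k / m!] and [(m+1)^k] is the sum of
    [m^#|S|] over the subsets [S] of a [k]-element set. *)

(** Binomial theorem for [(1 + m) ^ #|D|], with subsets grouped by size; [inord] loses nothing
    because [#|S| <= #|D|]. *)
Lemma sum_expn_subset (T : finType) (D : {set T}) (m : nat) :
  \sum_(S : {set T} | S \subset D) m ^ #|S| = m.+1 ^ #|D|.
Proof.
rewrite -add1n expnDn.
rewrite (partition_big (fun S : {set T} => inord #|S| : 'I_#|D|.+1) xpredT) //=.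
apply: eq_bigr => i _; rewrite exp1n mul1n -cards_draws.
rewrite -sum_nat_const; apply: congr_big => [//|S|S /andP[SD /eqP <-]].
  rewrite inE; have [SD|//] := boolP (S \subset D).
  by rewrite -val_eqE /= inordK // ltnS subset_leq_card.
by rewrite inordK // ltnS subset_leq_card.
Qed.

(** The bijection inserts [B] into a partition of [D :\: B]. A nonempty [B] is never already a block
    there, so deleting it undoes the insertion. *)
Lemma card_partition_with_block (T : finType) (D B : {set T})
    (Q : pred {set {set T}}) :
  B \subset D -> B != set0 ->
  #|[set P | [&& partition P D, B \in P & Q (P :\ B)]]| =
  #|[set P | partition P (D :\: B) & Q P]|.
Proof.
move=> BD B0.
have BP P : partition P (D :\: B) -> B \notin P.
  move=> PDB; apply/negP => /(partitionS PDB).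
  by rewrite subsetD => /andP[_]; rewrite -setI_eq0 setIid (negbTE B0).
rewrite -[RHS](card_in_imset (f := fun P => B |: P)); last first.
  move=> P1 P2; rewrite !inE => /andP[P1D _] /andP[P2D _] eqP12.
  by rewrite -(setU1K (BP _ P1D)) eqP12 setU1K // BP.
apply: eq_card => P; rewrite inE; apply/and3P/imsetP => [[PD inP QP]|[P']].
  by exists (P :\ B); rewrite ?setD1K // inE QP partitionD1.
rewrite inE => /andP[P'D QP'] ->; split; last by rewrite setU1K ?BP.
  rewrite -(setID D B) (setIidPr BD); apply: partitionU1 => //.
  by rewrite -setI_eq0 setIDA setIC -setIDA setDv setI0.
exact: setU11.
Qed.

Definition partitions {T : finType} (D : {set T}) : {set {set {set T}}} :=
  [set P | partition P D].

Lemma card_partitions0 (T : finType) : #|partitions (set0 : {set T})| = 1.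
Proof.
rewrite -(cards1 (set0 : {set {set T}})); apply: eq_card => P.
by rewrite !inE partition_set0.
Qed.

Definition partitions_avoiding {T : finType} (D S : {set T}) :
    {set {set {set T}}} :=
  [set P | partition P D & [forall x in S, [set x] \notin P]].

Lemma partitions_avoiding0 (T : finType) (D : {set T}) :
  partitions_avoiding D set0 = partitions D.
Proof.
apply/setP => P; rewrite !inE andb_idr // => _.
by apply/forall_inP => x; rewrite inE.
Qed.

(** Delete the block [[set x]]: as [x] lies outside [S], this leaves the condition on [S]
    unchanged. *)
Lemma card_partitions_avoiding_singleton (T : finType) (D S : {set T}) (x : T) :
  x \in D -> x \notin S ->
  #|[set P in partitions_avoiding D S | [set x] \in P]| =
  #|partitions_avoiding (D :\ x) S|.
Proof.
move=> xD xS; rewrite /partitions_avoiding.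
rewrite -(card_partition_with_block T D [set x]) ?sub1set -?card_gt0 ?cards1 //.
apply: eq_card => P; rewrite !inE -andbA [_ && ([set x] \in P)]andbC.
congr [&& _, _ & _]; apply: eq_forallb => y.
have [yS /=|//] := boolP (y \in S).
rewrite in_setD1 (inj_eq set1_inj).
by have [xy|//] := eqVneq y x; rewrite -xy yS in xS.
Qed.

(** Written as a sum to avoid truncated subtraction; the difference is taken later, in the reals. *)
Lemma card_partitions_avoidingD1 (T : finType) (D S : {set T}) (x : T) :
  x \in D -> x \in S ->
  #|partitions_avoiding D (S :\ x)| =
  #|partitions_avoiding D S| + #|partitions_avoiding (D :\ x) (S :\ x)|.
Proof.
move=> xD xS; rewrite addnC.
rewrite -card_partitions_avoiding_singleton ?setD11 //.
rewrite -(cardsID [set P : {set {set T}} | [set x] \in P] (partitions_avoiding D (S :\ x))).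
congr addn; apply: eq_card => P; rewrite !inE //.
rewrite andbCA; congr (_ && _).
apply/andP/forall_inP => [[xP /forall_inP SP] y yS|SP].
  by have [->//|yx] := eqVneq y x; apply: SP; rewrite !inE yx.
by split; [exact: SP | apply/forall_inP => y /setD1P[_]; exact: SP].
Qed.

(** Here [S] is the complement of the block of [x]; the other blocks form an arbitrary partition of
    [S]. *)
Lemma card_partitions_rec (T : finType) (D : {set T}) (x : T) :
  x \in D ->
  #|partitions D| =
  \sum_(S : {set T} | S \subset D :\ x) #|partitions S|.
Proof.
move=> xD; rewrite -sum1_card.
rewrite (partition_big (fun P => D :\: pblock P x)
  (fun S : {set T} => S \subset D :\ x)); last first.
  move=> P; rewrite inE => PD; rewrite setDS // sub1set mem_pblock.
  by rewrite (cover_partition PD).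
apply: eq_bigr => S SDx; rewrite sum1_card.
have [SD xS] := subsetD1P SDx.
have xDS : x \in D :\: S by rewrite inE xS.
have DDS : D :\: (D :\: S) = S by rewrite setDDr setDv set0U; apply/setIidPr.
(* As [D :\: S] contains [x], it is the block of [x] as soon as it is a block at all. *)
transitivity #|[set P | [&& partition P D, D :\: S \in P & true]]|.
  apply: eq_card => P; rewrite !inE andbT unfold_in /= inE.
  have [PD|//] := boolP (partition P D); rewrite /=.
  have tP := partition_trivIset PD.
  have Px : pblock P x \in P by rewrite pblock_mem // (cover_partition PD).
  apply/eqP/idP => [<-|DSP]; last by rewrite (def_pblock tP DSP xDS).
  by rewrite setDDr setDv set0U (setIidPr (partitionS PD Px)).
rewrite (card_partition_with_block T D (D :\: S) xpredT) ?subsetDl //; last first.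
  by apply/set0Pn; exists x.
by apply: eq_card => P; rewrite !inE andbT DDS.
Qed.

Lemma A_partitions_avoiding (n k : nat) (kn : k < n.+1) :
  A n k = #|partitions_avoiding ([set: 'I_n.+1] :\ Ordinal kn)
              [set j : 'I_n.+1 | k < j]|.
Proof.
rewrite -card_partitions_avoiding_singleton ?inE ?ltnn //.
apply: eq_card => P; rewrite !inE -andbA; congr (_ && _).
rewrite /largest_singleton /is_singleton.
apply/existsP/andP => [[i /and3P[/eqP ik iP /forall_inP iQ]]|[/forall_inP jP kP]].
  have -> : Ordinal kn = i by apply: val_inj.
  by split=> //; apply/forall_inP => j; rewrite inE -ik; exact: iQ.
exists (Ordinal kn); rewrite eqxx kP /=; apply/forall_inP => j kj.
by apply: jP; rewrite inE.
Qed.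

From mathcomp Require Import all_order all_algebra.
From mathcomp Require Import all_classical all_reals all_analysis.

Import Order.TTheory GRing.Theory Num.Theory.
Import numFieldNormedType.Exports.
Local Open Scope classical_set_scope.
Local Open Scope ring_scope.

Lemma cvg_series_shift (R : realType) (u : R^nat) (l : R) :
  u 0%N = 0 -> series (fun m => u m.+1) @ \oo --> l -> series u @ \oo --> l.
Proof.
move=> u0 ul; rewrite -cvg_shiftS; apply: cvg_trans ul.
apply: near_eq_cvg; near=> m.
by rewrite /series /= big_nat_recl // u0 add0r.
Unshelve. all: by end_near. Qed.

Lemma dobinski (R : realType) (T : finType) (D : {set T}) :
  series (fun m => m%:R ^+ #|D| / m`!%:R : R) @ \oo -->
  (#|partitions D|%:R * expR 1 : R).
Proof.
have [j] := ubnP #|D|; elim: j D => // j IHj D; rewrite ltnS => Dj.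
have [->|/set0Pn[x xD]] := eqVneq D finset.set0.
  rewrite card_partitions0 mul1r cards0.
  (* With [0 ^ 0 = 1], this is the exponential series at 1, including the term [m = 0]. *)
  have -> : (fun m => m%:R ^+ 0 / m`!%:R : R) = exp_coeff 1.
    by apply/funext => m; rewrite /exp_coeff /= expr0 expr1n.
  exact: is_cvg_series_exp_coeff.
have cDx : #|D| = #|D :\ x|.+1 by rewrite (cardsD1 x) xD.
(* The exponent is positive, so the term [m = 0] vanishes and the index can be shifted. One factor
   [m + 1] then cancels against [(m + 1)!]. *)
apply: cvg_series_shift; first by rewrite cDx expr0n mul0r.
have -> : (fun m => m.+1%:R ^+ #|D| / (m.+1)`!%:R : R) =
  (fun m => \sum_(S : {set T} | S \subset D :\ x) (m%:R ^+ #|S| / m`!%:R)).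
  apply/funext => m; rewrite -mulr_suml cDx exprS factS natrM invfM.
  rewrite mulrACA -mulrA mulVKf ?pnatr_eq0 //.
  under [in RHS]eq_bigr do rewrite -natrX.
  by rewrite -natr_sum sum_expn_subset natrX.
rewrite (card_partitions_rec _ _ _ xD) natr_sum mulr_suml.
have -> : series (fun m => \sum_(S : {set T} | S \subset D :\ x)
     (m%:R ^+ #|S| / m`!%:R : R)) =
  (fun N => \sum_(S : {set T} | S \subset D :\ x)
     series (fun m => m%:R ^+ #|S| / m`!%:R : R) N).
  by apply/funext => N; rewrite /series /= exchange_big.
apply: cvg_big => [|S SDx]; first exact: add_continuous.
by apply: IHj; rewrite (leq_trans _ Dj) // cDx ltnS subset_leq_card.
Qed.

(** Induction on [#|S|] with [D] free, since the recurrence needs both [D] and [D :\ x] as ground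
    sets. *)
Lemma cvg_partitions_avoiding (R : realType) (T : finType) (D S : {set T}) :
  S \subset D ->
  series (fun m => m%:R ^+ #|D :\: S| * (m%:R - 1) ^+ #|S| / m`!%:R : R) @ \oo
    --> (#|partitions_avoiding D S|%:R * expR 1 : R).
Proof.
have [j] := ubnP #|S|; elim: j D S => // j IHj D S; rewrite ltnS => Sj SD.
have [->|/set0Pn[x xS]] := eqVneq S finset.set0.
  rewrite partitions_avoiding0 finset.setD0 cards0.
  under eq_fun do rewrite expr0 mulr1.
  exact: dobinski.
have xD := fintype.subsetP SD x xS.
have cS : #|S| = #|S :\ x|.+1 by rewrite (cardsD1 x) xS.
have Sx : (#|S :\ x| < j)%N by rewrite -cS.
(* Dropping [x] from both sets keeps the exponent of [m]; dropping it from [S] alone raises that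
   exponent by one. *)
have DSx : D :\ x :\: (S :\ x) = D :\: S.
  by apply/setP => y; rewrite !inE; case: eqVneq => // ->; rewrite xS.
have cDS : #|D :\: (S :\ x)| = #|D :\: S|.+1.
  rewrite (cardsD1 x) !inE eqxx xD /= -DSx; congr _.+1.
  by apply: eq_card => y; rewrite !inE; case: eqVneq.
have cD := IHj D _ Sx (fintype.subset_trans (subD1set S x) SD).
have cDx := IHj (D :\ x) _ Sx (finset.setSD [set x]%SET SD).
rewrite cDS in cD; rewrite DSx in cDx.
rewrite (_ : #|_|%:R = #|partitions_avoiding D (S :\ x)|%:R -
    #|partitions_avoiding (D :\ x) (S :\ x)|%:R); last first.
  by rewrite (card_partitions_avoidingD1 _ _ _ _ xD xS) natrD addrK.
rewrite mulrBl (_ : series _ =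
    series (fun m => m%:R ^+ #|D :\: S|.+1 * (m%:R - 1) ^+ #|S :\ x| / m`!%:R) -
    series (fun m => m%:R ^+ #|D :\: S| * (m%:R - 1) ^+ #|S :\ x| / m`!%:R)).
  exact: cvgB cD cDx.
rewrite -seriesN -seriesD; congr series; apply/funext => m /=.
rewrite addrfctE opprfctE /= cS !exprS.
rewrite -mulrBl; congr (_ / _).
by rewrite mulrCA mulrBl mul1r mulrA.
Qed.

Theorem theorem2p2 (R : realType) (n k : nat) :
  let u : R^nat := fun m => m%:R ^+ k * (m%:R - 1) ^+ n / m`!%:R in
  cvgn (series u) /\
  (A (n + k) k)%:R = (expR 1)^-1 * limn (series u).
Proof.
move=> u.
have kn : (k < (n + k).+1)%N by rewrite ltnS leq_addl.
(* [S] holds the [n] ordinals above [k]; once [k] itself is removed, [D :\: S] holds the [k]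
   ordinals below it. *)
set S := [set j : 'I_(n + k).+1 | (k < j)%N]%SET.
set D := ([set: 'I_(n + k).+1]%SET :\ Ordinal kn)%SET.
have cS : #|S| = n.
  transitivity (\sum_(k.+1 <= j < (n + k).+1) 1)%N.
    by rewrite -sum1_card big_geq_mkord; apply: eq_bigl => j; rewrite inE.
  by rewrite sum_nat_const_nat muln1 subSS addnK.
have SD : S \subset D.
  by apply/fintype.subsetP => j; rewrite !inE andbT -val_eqE /=; case: ltngtP.
have cD : #|D| = (n + k)%N.
  have := cardsD1 (Ordinal kn) [set: 'I_(n + k).+1]%SET.
  by rewrite cardsT card_ord inE => -[].
have cDS : #|D :\: S| = k by rewrite cardsD (finset.setIidPr SD) cD cS addKn.
have ul : series u @ \oo --> ((A (n + k) k)%:R * expR 1 : R).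
  have := cvg_partitions_avoiding R _ D S SD.
  by rewrite cDS cS -A_partitions_avoiding.
split; first by apply/cvg_ex; exists ((A (n + k) k)%:R * expR 1).
by rewrite (cvg_lim _ ul) // mulrCA mulVf ?mulr1 // gt_eqF // expR_gt0.
Qed.
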